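(* Assume the interventions are soft, one on each latent node, in the setting of the context. For each node $j\in[q]$ let $c_j=-1$ if $\operatorname{rank}M[j]\neq\operatorname{rank}(M[j]\,|\,b[j])$, and $c_j=|\mathrm{ch}(j)|-\operatorname{rank}M[j]$ otherwise. Then the ideal $\mathcal{I}$ has dimension $\dim\mathcal{I}=-1$ if $c_j=-1$ for some $j\in[q]$, and $\dim\mathcal{I}=\sum_{j=1}^q c_j$ otherwise.
   Context: Setting: $p,q\ge2$; a DAG $\mathcal{G}$ on $[q]$ with $\mathrm{ch}(j)=\{i: j\to i\in\mathcal{G}\}$ and $\mathrm{de}(j)$ the set of nodes $i\ne j$ reachable from $j$ by a directed path. True parameters: a generic $\widetilde F\in\mathbb{R}^{p\times q}$, a matrix $\widetilde\Lambda^{(0)}$ with $(\widetilde\Lambda^{(0)})_{i,j}\ne0$ iff $j\to i\in\mathcal{G}$ with generic nonzero entries, and for $k\in[q]$ a matrix $\widetilde\Lambda^{(k)}$ (soft intervention on node $k$) agreeing with $\widetilde\Lambda^{(0)}$ except in row $k$, whose nonzero entries are generic, supported on the same positions, and all differ from those of $\widetilde\Lambda^{(0)}$. Set $A^{(k)}=\widetilde F(I-\widetilde\Lambda^{(k)})^{-1}$ for $k=0,\dots,q$, and $\Delta^{(k)}=(I-\widetilde\Lambda^{(k)})^{-1}-(I-\widetilde\Lambda^{(0)})^{-1}$. Let $\mathcal{I}$ be the ideal generated by the entries of $F-A^{(k)}(I-\Lambda^{(k)})$, $k=0,\dots,q$, in the polynomial ring whose indeterminates are the entries $f_{\ell,j}$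 of $F$ ($\ell\in[p],j\in[q]$), $\lambda^{(0)}_{i,j}$ for each edge $j\to i$ of $\mathcal{G}$, and $\lambda^{(k)}_{k,j}$ for each edge $j\to k$ of $\mathcal{G}$; here $\Lambda^{(0)}$ has entries $\lambda^{(0)}_{i,j}$ on edges and $0$ elsewhere, and $\Lambda^{(k)}$ equals $\Lambda^{(0)}$ with row $k$ replaced by the $\lambda^{(k)}_{k,j}$. $\dim\mathcal{I}$ is the dimension of the affine variety of $\mathcal{I}$ (equal to $-1$ if empty). For $j\in[q]$, $M[j]$ is the matrix with rows indexed by $k\in\mathrm{de}(j)\setminus\mathrm{ch}(j)$, columns by $i\in\mathrm{ch}(j)$, and entries $\Delta^{(k)}_{k,i}$; $b[j]$ is the column vector indexed by $k\in\mathrm{de}(j)\setminus\mathrm{ch}(j)$ with entries $\Delta^{(k)}_{k,j}$; $(M[j]\,|\,b[j])$ is the augmented matrix. *)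

(* Defs.v *)
From HB Require Import structures.
From mathcomp Require Import all_boot all_order all_algebra.
From mathcomp Require Import reals.
From mathcomp Require Import mpoly.

Set Implicit Arguments.
Unset Strict Implicit.
Unset Printing Implicit Defensive.

Import Order.TTheory GRing.Theory Num.Theory.
Local Open Scope ring_scope.

(* A graph on [q] = 'I_q is a relation G; G j i means the edge j -> i. *)
Definition is_DAG (q : nat) (G : rel 'I_q) : Prop :=
  forall i j : 'I_q, G i j -> ~~ connect G j i.

Definition ch (q : nat) (G : rel 'I_q) (j : 'I_q) : {set 'I_q} :=
  [set i | G j i].
Definition de (q : nat) (G : rel 'I_q) (j : 'I_q) : {set 'I_q} :=
  [set i | (i != j) && connect G j i].

(* Edge index type: pairs (i, j) with j -> i in G (position (i,j) of Lambda). *)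
Definition edge_pred (q : nat) (G : rel 'I_q) : pred ('I_q * 'I_q) :=
  fun e => G e.2 e.1.
Definition Edge (q : nat) (G : rel 'I_q) := {e : 'I_q * 'I_q | edge_pred G e}.

(* Index type of all parameters / indeterminates:
   inl (l, j)         : f_{l,j}
   inr (inl (i, j))   : lambda^(0)_{i,j}   for an edge j -> i
   inr (inr (k, j))   : lambda^(k)_{k,j}   for an edge j -> k            *)
Definition Var (p q : nat) (G : rel 'I_q) : finType :=
  (('I_p * 'I_q) + (Edge G + Edge G))%type.

Definition nvar (p q : nat) (G : rel 'I_q) : nat := #|Var p G|.

Section Param.
Variables (p q : nat) (G : rel 'I_q) (T : pzRingType).
Variable x : Var p G -> T.

Definition Fmx : 'M[T]_(p, q) := \matrix_(l < p, j < q) x (inl (l, j)).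

(* Lambda^(k): k = None is the observational matrix Lambda^(0),
   k = Some k0 is the matrix with row k0 replaced by the lambda^(k0)_{k0,j}. *)
Definition Lmx (k : option 'I_q) : 'M[T]_q :=
  \matrix_(i < q, j < q)
    match @insub _ (edge_pred G) (Edge G) (i, j) with
    | Some e => if k == Some i then x (inr (inr e)) else x (inr (inl e))
    | None => 0
    end.
End Param.

Section Model.
Variables (R : realType) (p q : nat) (G : rel 'I_q).

Definition Poly := {mpoly R[nvar p G]}.
Definition Xv (v : Var p G) : Poly := 'X_(enum_rank v).

Variable theta : 'I_(nvar p G) -> R.
Definition th (v : Var p G) : R := theta (enum_rank v).

Definition Ftrue : 'M[R]_(p, q) := Fmx th.
Definition Ltrue (k : option 'I_q) : 'M[R]_q := Lmx th k.

Definition Amx (k : option 'I_q) : 'M[R]_(p, q) :=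
  Ftrue *m invmx (1%:M - Ltrue k).

Definition gen (k : option 'I_q) (l : 'I_p) (j : 'I_q) : Poly :=
  (Fmx Xv - map_mx (fun c : R => c%:MP) (Amx k) *m (1%:M - Lmx Xv k)) l j.

Definition gens : Poly -> Prop :=
  fun f => exists k l j, f = gen k l j.

Definition Delta (k : 'I_q) : 'M[R]_q :=
  invmx (1%:M - Ltrue (Some k)) - invmx (1%:M - Ltrue None).

Definition Rset (j : 'I_q) : {set 'I_q} := de G j :\: ch G j.

Definition Mj (j : 'I_q) : 'M[R]_(#|Rset j|, #|ch G j|) :=
  \matrix_(a < #|Rset j|, b < #|ch G j|)
     let k := enum_val a in Delta k k (enum_val b).

Definition bj (j : 'I_q) : 'cV[R]_(#|Rset j|) :=
  \col_(a < #|Rset j|) let k := enum_val a in Delta k k j.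

Definition cj (j : 'I_q) : int :=
  if \rank (Mj j) != \rank (row_mx (Mj j) (bj j)) then -1
  else (#|ch G j|%:Z - (\rank (Mj j))%:Z).

Definition param_conditions : Prop :=
  (forall e : Edge G, th (inr (inl e)) != 0) /\
  (forall e : Edge G, th (inr (inr e)) != 0) /\
  (forall e : Edge G, th (inr (inr e)) != th (inr (inl e))).
End Model.

Section Krull.
Variable A : comPzRingType.

Definition is_ideal (S : A -> Prop) : Prop :=
  [/\ S 0, (forall a b, S a -> S b -> S (a + b)) &
      (forall r a, S a -> S (r * a))].

Definition is_prime_ideal (S : A -> Prop) : Prop :=
  [/\ is_ideal S, ~ S 1 & (forall a b, S (a * b) -> S a \/ S b)].

Definition prime_chain (gs : A -> Prop) (n : nat) : Prop :=
  exists P : nat -> (A -> Prop),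
    (forall i, (i <= n)%N -> is_prime_ideal (P i) /\ (forall f, gs f -> P i f)) /\
    (forall i, (i < n)%N ->
       (forall f, P i f -> P i.+1 f) /\ (exists f, P i.+1 f /\ ~ P i f)).

(* dim of the ideal generated by gs is d (Krull dimension of A/<gs>),
   with the convention d = -1 when the ideal is the whole ring. *)
Definition ideal_dim_is (gs : A -> Prop) (d : int) : Prop :=
  (d = -1 /\ ~ prime_chain gs 0) \/
  (exists n : nat, d = n%:Z /\ prime_chain gs n /\ ~ prime_chain gs n.+1).
End Krull.

(* Main.v *)
(** The generators are affine-linear.  Since Lambda^(k) and Lambda^(0) differ only
    in row k, [Delta k] has rank one, and the equations of index k minus those of
    index 0 read [a_k r_k = 0], where [a_k] is column k of A^(0), nonzero for
    generic parameters.  Entry j of the row vector [r_k] fixes lambda^(k)_{k,j}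
    when j -> k is an edge, is a row of [M[j] lambda = b[j]] when k is another
    descendant of j, and vanishes identically otherwise.  The true parameters
    solve the system, so it is consistent, and the quotient by the ideal is a
    polynomial ring in [sum_j dim (ker M[j])] variables.

    Krull dimension of K[t_1, .., t_n]: given primes P_0 < .. < P_(n+1), choose
    f_i in P_(i+1) but not in P_i.  The n+1 polynomials f_i are algebraically
    dependent, and dividing a relation by the lexicographically least monomial,
    one variable at a time, places a nonzero constant in P_(n+1). *)

Require Import Defs.
From HB Require Import structures.
From mathcomp Require Import all_boot all_order all_algebra.
From mathcomp Require Import reals.
From mathcomp Require Import mpoly.
Import Order.TTheory GRing.Theory Num.Theory.
Local Open Scope ring_scope.

Set Implicit Arguments.
Unset Strict Implicit.
Unset Printing Implicit Defensive.

(** * Ideals and relations along a chain of primes *)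

Section Ideals.
Variable A : comPzRingType.
Implicit Type P : A -> Prop.

Lemma ideal_sum P (I : Type) (r : seq I) (Q : pred I) (F : I -> A) :
  is_ideal P -> (forall i, Q i -> P (F i)) -> P (\sum_(i <- r | Q i) F i).
Proof. by case=> P0 PD _ PF; elim/big_ind: _ => //; exact: PD. Qed.

Lemma idealN P a : is_ideal P -> P a -> P (- a).
Proof. by case=> _ _ PM Pa; rewrite -mulN1r; exact: PM. Qed.

Lemma idealB P a b : is_ideal P -> P a -> P b -> P (a - b).
Proof. by move=> iP Pa Pb; have [_ PD _] := iP; apply: PD => //; exact: idealN. Qed.

Lemma prime_ideal_cancelX P x y n :
  is_prime_ideal P -> ~ P x -> P (x ^+ n * y) -> P y.
Proof.
case=> _ _ pP Px; elim: n => [|n IHn]; first by rewrite mul1r.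
by rewrite exprS -mulrA => /pP[|/IHn].
Qed.

(* Among the exponents in [B], those minimal in the first coordinate [i] give
   the part of the relation that survives division by a power of [f i]
   (allowed, as [f i] is not in [P i]) and reduction modulo [P i.+1]. *)
Lemma prime_chain_no_relation (m : nat) (P : nat -> A -> Prop) (f : nat -> A)
    (I : finType) (c : I -> A) (e : I -> nat -> nat) :
    (forall i, (i <= m)%N -> is_prime_ideal (P i)) ->
    (forall i, (i < m)%N ->
       [/\ forall g, P i g -> P i.+1 g, P i.+1 (f i) & ~ P i (f i)]) ->
  forall (i : nat) (B : {set I}), (i <= m)%N -> B != set0 ->
    (forall b, b \in B -> ~ P m (c b)) ->
    {in B &, forall b b',
       (forall j, (i <= j < m)%N -> e b j = e b' j) -> b = b'} ->
  ~ P i (\sum_(b in B) c b * \prod_(i <= j < m) f j ^+ e b j).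
Proof.
move=> primeP stepP i B le_im; move: {2}(m - i)%N (erefl (m - i)%N) => k.
elim: k i B le_im => [|k IHk] i B le_im def_k B0 cB injB.
  have def_i : i = m by apply/eqP; rewrite eqn_leq le_im -subn_eq0 def_k.
  rewrite {i le_im def_k}def_i in injB *; have [b Bb] := set0Pn _ B0.
  suff -> : B = [set b] by rewrite big_set1 big_geq // mulr1; exact: cB.
  apply/setP=> b'; rewrite inE; apply/idP/eqP => [Bb'|->//].
  by apply: injB => // j /andP[le_mj /(leq_ltn_trans le_mj)]; rewrite ltnn.
have lt_im : (i < m)%N by rewrite -subn_gt0 def_k.
have [sPi Pfi nPfi] := stepP _ lt_im.
have [b1 Bb1] := set0Pn _ B0.
have [b0 Bb0 min_b0] := arg_minnP (P := fun b => b \in B) (fun b => e b i) Bb1.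
pose B' := [set b in B | e b i == e b0 i].
have iPi1 : is_ideal (P i.+1) by have [] := primeP _ lt_im.
move=> PiS; apply: (IHk i.+1 B') => //.
- by rewrite subnS def_k.
- by apply/set0Pn; exists b0; rewrite inE Bb0 eqxx.
- by move=> b; rewrite inE => /andP[Bb _]; exact: cB.
- move=> b b'; rewrite !inE => /andP[Bb /eqP eb] /andP[Bb' /eqP eb'] eqbb'.
  apply: injB => // j; rewrite leq_eqVlt => /andP[/predU1P[<- _|lt_ij lt_jm]].
    by rewrite eb eb'.
  by apply: eqbb'; rewrite lt_ij.
(* [Y] is the relation divided by the least power of [f i]; primality keeps it in [P i]. *)
pose Y := \sum_(b in B)
  c b * (f i ^+ (e b i - e b0 i) * \prod_(i.+1 <= j < m) f j ^+ e b j).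
have PY : P i.+1 Y.
  apply/sPi/(prime_ideal_cancelX (primeP _ le_im) nPfi (n := e b0 i)).
  move: PiS; congr (P i _); rewrite /Y mulr_sumr; apply: eq_bigr => b Bb.
  have le_b0 : (e b0 i <= e b i)%N by exact: min_b0.
  by rewrite (big_ltn lt_im) [RHS]mulrCA [in RHS](mulrA (f i ^+ _)) -exprD subnKC.
(* The discarded terms still contain a factor [f i], which lies in [P i.+1]. *)
have -> : \sum_(b in B') c b * \prod_(i.+1 <= j < m) f j ^+ e b j =
    Y - \sum_(b in B | e b i != e b0 i)
      c b * (f i ^+ (e b i - e b0 i) * \prod_(i.+1 <= j < m) f j ^+ e b j).
  rewrite /Y [X in _ = X - _](bigID (fun b => e b i == e b0 i)) /= addrK.
  apply: eq_big => [b|b]; rewrite inE // => /andP[_ /eqP ->].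
  by rewrite subnn mul1r.
apply: idealB => //; apply: ideal_sum => // b /andP[Bb neb].
have: (e b i - e b0 i > 0)%N by rewrite subn_gt0 ltn_neqAle eq_sym neb; exact: min_b0.
case: (_ - _)%N => // d _; have [_ _ PM] := iPi1.
by rewrite exprS -mulrA mulrCA mulrC; exact: PM.
Qed.

End Ideals.

(** * Algebraic dependence of n + 1 polynomials in n variables *)

Section Dependence.
Variables (K : fieldType) (n : nat).
Implicit Types f g : {mpoly K[n]}.

Lemma msizeM_leS f g a b :
  (msize f <= a.+1)%N -> (msize g <= b.+1)%N -> (msize (f * g) <= (a + b).+1)%N.
Proof.
have [->|f0] := eqVneq f 0; first by rewrite mul0r msize0.
have [->|g0] := eqVneq g 0; first by rewrite mulr0 msize0.
rewrite msizeM // => lef leg; rewrite -ltnS -addSn -addnS.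
by rewrite prednK ?leq_add // addn_gt0 lt0n mmeasure_poly_eq0 f0.
Qed.

Lemma msizeX_leS f a k : (msize f <= a.+1)%N -> (msize (f ^+ k) <= (k * a).+1)%N.
Proof.
move=> lef; elim: k => [|k IHk]; first by rewrite expr0 msize1.
by rewrite exprS mulSn; exact: msizeM_leS.
Qed.

Lemma card_bmultinom_le (b : nat) : (#|{: 'X_{1..n < b.+1}}| <= b.+1 ^ n)%N.
Proof.
pose h (m : 'X_{1..n < b.+1}) : {ffun 'I_n -> 'I_b.+1} := [ffun i => inord (m i)].
have -> : (b.+1 ^ n = #|{ffun 'I_n -> 'I_b.+1}|)%N by rewrite card_ffun !card_ord.
apply: (@leq_card _ _ h) => m m' /ffunP eq_h; apply/val_inj/mnmP => i.
have lt_m (m0 : 'X_{1..n < b.+1}) : (m0 i < b.+1)%N.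
  by apply: leq_ltn_trans (bmdeg m0); rewrite mdegE (bigD1 i) //= leq_addr.
by have := eq_h i; rewrite !ffunE => /(congr1 val); rewrite /= !inordK.
Qed.

(* Products of the [f j] with exponents at most [e] have degree [O(e)], hence
   live in a space of dimension [O(e ^ n)], while there are [e.+1 ^ n.+1] of
   them. *)
Lemma mpoly_dependent (f : nat -> {mpoly K[n]}) :
  exists e (c : {ffun 'I_n.+1 -> 'I_e} -> K),
    (exists a, c a != 0) /\
    \sum_a (c a)%:MP * \prod_(0 <= j < n.+1) f j ^+ a (inord j) = 0.
Proof.
pose D := (\sum_(j < n.+1) msize (f j))%N.
(* This choice gives [b.+1 <= C * e.+1] for the degree bound [b] below, whence
   [b.+1 ^ n <= e * e.+1 ^ n < e.+1 ^ n.+1]: fewer monomials than products. *)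
pose C := (n.+1 * D).+1; have [e def_e] : exists e, (C ^ n)%N = e by eexists.
have szf j : (j < n.+1)%N -> (msize (f j) <= D.+1)%N.
  move=> lt_jn; rewrite /D (bigD1 (Ordinal lt_jn)) //= -addnS; exact: leq_addr.
pose b := (n.+1 * (e * D))%N.
pose T := {ffun 'I_n.+1 -> 'I_e.+1}.
pose F (a : T) := \prod_(0 <= j < n.+1) f j ^+ a (inord j).
have szF a : (msize (F a) <= b.+1)%N.
  rewrite /F big_mkord /b.
  have -> : (n.+1 * (e * D) = \sum_(j < n.+1) e * D)%N by rewrite sum_nat_const card_ord.
  elim/big_rec2: _ => [|j d g _ IH]; first by rewrite msize1.
  apply: msizeM_leS => //; apply: leq_trans (msizeX_leS _ (szf _ (ltn_ord j))) _.
  by rewrite ltnS leq_mul2r -ltnS ltn_ord orbT.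
pose M : 'M[K]_(#|{: T}|, #|{: 'X_{1..n < b.+1}}|) :=
  \matrix_(s, t) (F (enum_val s))@_(enum_val t : 'X_{1..n < b.+1}).
have rankM : (\rank M < #|{: T}|)%N.
  apply: leq_ltn_trans (rank_leq_col M) _.
  apply: leq_ltn_trans (card_bmultinom_le b) _.
  rewrite card_ffun !card_ord; apply: (@leq_ltn_trans ((C * e.+1) ^ n)).
    have [n0|n_gt0] := posnP n.
      by rewrite [X in (_ ^ X)%N]n0 [X in (_ <= _ ^ X)%N]n0.
    by rewrite leq_exp2r // /b /C mulnS [(_.+1 * e)%N]mulSn [(e * D)%N]mulnC
               mulnA addSn ltnS addnA leq_addl.
  by rewrite expnMn def_e expnS ltn_pmul2r ?expn_gt0 // ltnSn.
have [v v0 vM] : exists2 v : 'rV_(#|{: T}|), v != 0 & v *m M = 0.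
  have /rowV0Pn[v vK v0] : kermx M != 0.
    by rewrite -mxrank_eq0 mxrank_ker subn_eq0 -ltnNge.
  by exists v => //; apply/sub_kermxP.
exists e.+1, (fun a => v 0 (enum_rank a)); split.
  by have /rV0Pn[s vs] := v0; exists (enum_val s); rewrite enum_valK.
apply/mpolyP=> m; rewrite mcoeff0 raddf_sum /=.
under eq_bigr do rewrite mcoeffCM -/(F _).
have [lt_mb|le_bm] := ltnP (mdeg m) b.+1; last first.
  apply: big1 => a _; apply/eqP; rewrite mulf_eq0 mcoeff_eq0.
  by rewrite (msize_mdeg_ge (leq_trans (szF a) le_bm)) orbT.
have /matrixP/(_ 0 (enum_rank (BMultinom lt_mb))) := vM.
rewrite !mxE (reindex enum_rank) /=; last exact/onW_bij/enum_rank_bij.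
by move=> {2}<-; apply: eq_bigr => a _; rewrite mxE !enum_rankK.
Qed.
End Dependence.

(** * Krull dimension through a polynomial parametrization *)

Lemma finite_choice (T : Type) (x0 : T) (Q : nat -> T -> Prop) (m : nat) :
  (forall i, (i < m)%N -> exists x, Q i x) ->
  exists h : nat -> T, forall i, (i < m)%N -> Q i (h i).
Proof.
elim: m => [|m IHm] exQ; first by exists (fun=> x0).
have [|h hQ] := IHm; first by move=> i /ltnW; exact: exQ.
have [x Qx] := exQ m (ltnSn m).
exists (fun i => if i == m then x else h i) => i; rewrite ltnS leq_eqVlt.
by case: eqVneq => [->|_] //=; exact: hQ.
Qed.

Lemma kernel_prime_ideal (A : comPzRingType) (B : idomainType)
    (phi : {rmorphism A -> B}) : is_prime_ideal (fun a => phi a = 0).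
Proof.
split; [split|..].
- exact: rmorph0.
- by move=> a b a0 b0; rewrite rmorphD a0 b0 addr0.
- by move=> r a a0; rewrite rmorphM a0 mulr0.
- by rewrite rmorph1 => /eqP; rewrite oner_eq0.
- by move=> a b /eqP; rewrite rmorphM mulf_eq0 => /orP[] /eqP; [left|right].
Qed.

(** The [f] congruent to [phi f] modulo [P] are closed under sums, scalar multiples and products, so
    the variables decide. *)
Lemma lrmorphism_congr (K : fieldType) (N : nat) (P : {mpoly K[N]} -> Prop)
    (phi : {lrmorphism {mpoly K[N]} -> {mpoly K[N]}}) :
    is_ideal P -> (forall v, P ('X_v - phi 'X_v)) -> forall f, P (f - phi f).
Proof.
move=> iP Pw; have [P0 PD PM] := iP.
have PphiM f g : P (f - phi f) -> P (g - phi g) -> P (f * g - phi (f * g)).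
  move=> Pf Pg; have -> : f * g - phi (f * g) =
      g * (f - phi f) + phi f * (g - phi g).
    by rewrite rmorphM !mulrBr addrA [phi f * g]mulrC [g * f]mulrC addrNK.
  by apply: PD; exact: PM.
have Pphi1 : P (1 - phi 1) by rewrite rmorph1 subrr.
elim/mpolyind => [|c m f _ _ IHf]; first by rewrite rmorph0 subrr.
rewrite (linearD phi) opprD addrACA; apply: (PD) => //.
rewrite (linearZ_LR phi) /= -scalerBr -mul_mpolyC; apply: (PM).
rewrite mpolyXE_id; elim/big_ind: _ => // i _.
by elim: (m i) => [|k IHk] //; rewrite exprS; apply: PphiM.
Qed.

(** The hypotheses make [w] and [u] inverse isomorphisms between the quotient by [gs] and the
    polynomial ring in [n] variables. Quantifying over all ideals containing [gs] avoids
    constructing the generated one. *)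
Lemma krull_dim_poly (K : fieldType) (N n : nat) (gs : {mpoly K[N]} -> Prop)
    (w : N.-tuple {mpoly K[n]}) (u : n.-tuple {mpoly K[N]}) :
    (forall f, gs f -> f \mPo w = 0) ->
    (forall m, tnth u m \mPo w = 'X_m) ->
    (forall P, is_ideal P -> (forall f, gs f -> P f) ->
       forall v, P ('X_v - (tnth w v \mPo u))) ->
  ideal_dim_is gs n%:Z.
Proof.
move=> gs_w u_w x_wu; right; exists n; split=> //; split.
  (* [z i] sets the first [i] variables to 0. The kernels of [w] followed by [z i] form the chain,
     and the lift by [u] of variable [i] shows that step [i] is strict. *)
  pose z i : n.-tuple {mpoly K[n]} :=
    [tuple if (m < i)%N then 0 else 'X_m | m < n].
  exists (fun i f => (f \mPo w) \mPo z i = 0); split=> [i _|i lt_in].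
    split; last by move=> f /gs_w ->; rewrite rmorph0.
    exact: (kernel_prime_ideal (comp_mpoly (z i) \o comp_mpoly w)).
  split=> [f f0|].
    have zS (g : {mpoly K[n]}) : g \mPo z i.+1 = (g \mPo z i) \mPo z i.+1.
      apply/eqP; rewrite -subr_eq0 -rmorphB; apply/eqP.
      apply: (lrmorphism_congr (P := fun h => h \mPo z i.+1 = 0)
                               (phi := comp_mpoly (z i))) => [|v] /=.
        by have [] := kernel_prime_ideal (comp_mpoly (z i.+1)).
      rewrite rmorphB /= !comp_mpolyXU -!tnth_nth !tnth_mktuple.
      case: (ltnP v i) => [lt_vi|_]; first by rewrite rmorph0 (leqW lt_vi) subrr.
      by rewrite comp_mpolyXU -tnth_nth tnth_mktuple subrr.
    by rewrite zS f0 rmorph0.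
  exists (tnth u (Ordinal lt_in)); rewrite u_w !comp_mpolyXU -!tnth_nth !tnth_mktuple.
  rewrite ltnSn ltnn; split=> // /mpolyP/(_ U_(Ordinal lt_in)%MM)/eqP.
  by rewrite mcoeffXU eqxx mcoeff0 oner_eq0.
case=> P [primeP stepP].
have [f fP] := finite_choice 0 (fun i lt => proj2 (stepP i lt)).
have [e [c [[a0 ca0] rel]]] := mpoly_dependent (fun j => f j \mPo w).
have iP i : (i <= n.+1)%N -> is_ideal (P i) by case/primeP => [[]].
pose B := [set a | c a != 0].
apply: (@prime_chain_no_relation _ n.+1 P f _ (fun a => (c a)%:MP)
          (fun a j => a (inord j)) _ _ 0 B) => //.
- by move=> i /primeP[].
- by move=> i lt_in; have [Pf nPf] := fP i lt_in; split=> //; have [] := stepP i lt_in.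
- by apply/set0Pn; exists a0; rewrite inE.
- move=> a; rewrite inE => ca Pc; have [[_ nP1 _] _] := primeP n.+1 (leqnn _).
  apply: nP1; have [_ _ PM] := iP n.+1 (leqnn _).
  by have := PM (c a)^-1%:MP _ Pc; rewrite -mpolyCM mulVf.
- move=> a a' _ _ eqa; apply/ffunP=> j; apply/val_inj.
  by have := eqa j (ltn_ord j); rewrite inord_val.
set S := \sum_(a in B) _.
have iP0 : is_ideal (P 0%N) by exact: iP.
(* Modulo [P 0], [S] agrees with its image under [w] then [u], which is zero by the relation
   [rel]. *)
have: P 0%N (S - (comp_mpoly u \o comp_mpoly w) S).
  apply: lrmorphism_congr => // v; rewrite /= comp_mpolyXU -tnth_nth.
  by apply: x_wu => //; have [] := primeP 0%N isT.
rewrite /=; suff -> : S \mPo w = 0 by rewrite rmorph0 subr0.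
rewrite -rel /S big_mkcond rmorph_sum /=; apply: eq_bigr => a _.
rewrite inE; case: eqVneq => [->|_] /=; first by rewrite rmorph0 mpolyC0 mul0r.
rewrite rmorphM rmorph_prod /= comp_mpolyC; congr (_ * _).
by apply: eq_bigr => j _; rewrite rmorphXn.
Qed.

(** * Constant matrices under substitution; complement of a kernel *)

Lemma map_mx_comp_mpolyC (R : nzRingType) N n (t : N.-tuple {mpoly R[n]}) a b
    (Y : 'M[R]_(a, b)) :
  map_mx (comp_mpoly t) (map_mx (@mpolyC N R) Y) = map_mx (@mpolyC n R) Y.
Proof. by rewrite -map_mx_comp; apply: eq_map_mx => c /=; rewrite comp_mpolyC. Qed.

(** The rows of [1 - A *m pinvmx A] lie in the span of [W], which [1 - pinvmx W *m W] annihilates.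
    Hence the part of a vector [v] outside the kernel is a linear function of [v *m A]. *)
Lemma kernel_complement (K : fieldType) m n (A : 'M[K]_(m, n)) :
  let W := row_base (kermx A) in
  exists Z : 'M_(n, m), 1%:M - pinvmx W *m W = A *m Z.
Proof.
move=> W; have /submxP[Y defY] : (1%:M - A *m pinvmx A <= W)%MS.
  rewrite eq_row_base; apply/sub_kermxP.
  by rewrite mulmxBl mul1mx mulmxKpV ?subrr.
have WX : W *m (1%:M - pinvmx W *m W) = 0.
  by rewrite mulmxBr mulmx1 mulmxA mulmxVp ?row_base_free // mul1mx subrr.
set X := 1%:M - _ in WX *; exists (pinvmx A *m X); apply/eqP.
by rewrite mulmxA -subr_eq0 -{1}[X]mul1mx -mulmxBl defY -mulmxA WX mulmx0.
Qed.

(** * Matrices supported on an acyclic graph *)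

Section DagMatrix.
Variables (K : fieldType) (q : nat) (G : rel 'I_q).
Hypothesis dagG : is_DAG G.

(** Induction on the number of nodes that reach [i]: passing to a parent loses [i] itself, by
    acyclicity. *)
Lemma dag_ind (Q : 'I_q -> Prop) :
  (forall i, (forall m, G m i -> Q m) -> Q i) -> forall i, Q i.
Proof.
move=> IH i; move: {2}_.+1 (ltnSn #|[set m | connect G m i]|) => k.
elim: k i => // k IHk i lt_k; apply: IH => m Gmi; apply: IHk.
rewrite ltnS in lt_k; apply: leq_trans lt_k; apply: proper_card.
apply/properP; split.
  apply/subsetP=> s; rewrite !inE => /connect_trans; apply; exact: connect1.
by exists i; rewrite !inE ?connect0 //; exact: dagG.
Qed.

Variable L : 'M[K]_q.
Hypothesis suppL : forall i j, ~~ G j i -> L i j = 0.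

(** A row vector killed by the transpose has each entry [u_i] equal to a combination of the [u_m]
    over parents [m] of [i], so it vanishes by induction along the graph. *)
Lemma dag_unitmx : 1%:M - L \in unitmx.
Proof.
rewrite -unitmx_tr -row_free_unit -kermx_eq0; apply/rowV0P => u /sub_kermxP uL.
apply/rowP; elim/dag_ind => i IH; rewrite [RHS]mxE.
have /rowP/(_ i) := uL; rewrite linearB /= trmx1 mulmxBr mulmx1 !mxE.
move/eqP; rewrite subr_eq0 => /eqP ->; apply: big1 => m _; rewrite mxE.
have [Gmi|/suppL ->] := boolP (G m i); last by rewrite mulr0.
by rewrite IH // mxE mul0r.
Qed.

Let B := invmx (1%:M - L).

Lemma dag_invE i j : B i j = (i == j)%:R + \sum_m L i m * B m j.
Proof.
have /matrixP/(_ i j) := mulmxV dag_unitmx.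
rewrite mulmxBl mul1mx !mxE => /eqP.
by rewrite subr_eq => /eqP.
Qed.

Lemma dag_inv0 i j : ~~ connect G j i -> B i j = 0.
Proof.
elim/dag_ind: i => i IH nji; rewrite dag_invE.
case: eqVneq nji => [->|_ nji]; first by rewrite connect0.
rewrite add0r big1 // => m _.
have [Gmi|/suppL ->] := boolP (G m i); last by rewrite mul0r.
rewrite IH ?mulr0 //; apply: contra nji => /connect_trans; apply.
exact: connect1.
Qed.

Lemma dag_inv_diag j : B j j = 1.
Proof.
rewrite dag_invE eqxx big1 ?addr0 // => m _.
have [Gmj|/suppL ->] := boolP (G m j); last by rewrite mul0r.
by rewrite dag_inv0 ?mulr0 //; exact: dagG.
Qed.

End DagMatrix.

(** * Supports and base change for F and Lambda *)

Section LmxTheory.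
Variables (p q : nat) (G : rel 'I_q).

Lemma Lmx0 (S : pzRingType) (x : Var p G -> S) k i j :
  ~~ G j i -> Lmx x k i j = 0.
Proof.
by move=> nG; rewrite mxE; case: insubP => // e; rewrite /edge_pred /= (negPf nG).
Qed.

Lemma Lmx_edge (S : pzRingType) (x : Var p G -> S) k (e : Edge G) :
  Lmx x k (val e).1 (val e).2 =
  if k == Some (val e).1 then x (inr (inr e)) else x (inr (inl e)).
Proof. by rewrite mxE -surjective_pairing valK. Qed.

Lemma Lmx_row (S : pzRingType) (x : Var p G -> S) k i j :
  i != k -> Lmx x (Some k) i j = Lmx x None i j.
Proof.
move=> ik; rewrite !mxE; case: insubP => // e _ _.
by rewrite (inj_eq Some_inj) eq_sym (negPf ik).
Qed.

Lemma map_Lmx (S S' : pzRingType) (phi : {rmorphism S -> S'}) (x : Var p G -> S) k :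
  map_mx phi (Lmx x k) = Lmx (phi \o x) k.
Proof.
apply/matrixP=> i j; rewrite !mxE; case: insubP => [e _ _|_] /=; last exact: rmorph0.
by case: ifP.
Qed.

Lemma eq_Lmx (S : pzRingType) (x y : Var p G -> S) k : x =1 y -> Lmx x k = Lmx y k.
Proof.
move=> xy; apply/matrixP=> i j; rewrite !mxE.
by case: insub => // e; rewrite !xy.
Qed.

Lemma eq_Fmx (S : pzRingType) (x y : Var p G -> S) : x =1 y -> Fmx x = Fmx y.
Proof. by move=> xy; apply/matrixP=> i j; rewrite !mxE. Qed.

Lemma map_Fmx (S S' : pzRingType) (phi : {rmorphism S -> S'}) (x : Var p G -> S) :
  map_mx phi (Fmx x) = Fmx (phi \o x).
Proof. by apply/matrixP=> i j; rewrite !mxE. Qed.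

Lemma Lmx_diff (S : pzRingType) (x : Var p G -> S) k :
  Lmx x (Some k) = Lmx x None + delta_mx k 0 *m row k (Lmx x (Some k) - Lmx x None).
Proof.
apply/matrixP=> i j; rewrite [RHS]mxE [X in _ + X]mxE big_ord1.
rewrite [delta_mx _ _ _ _]mxE eqxx andbT [row _ _ _ _]mxE [X in _ * X]mxE.
rewrite [X in _ * (_ + X)]mxE.
case: (eqVneq i k) => [->|ik]; first by rewrite mul1r addrC subrK.
by rewrite mul0r addr0; exact: Lmx_row.
Qed.

End LmxTheory.

(** * Effect of a single intervention *)

Section ModelTheory.
Variables (R : realType) (p q : nat) (G : rel 'I_q).
Hypothesis dagG : is_DAG G.
Variable theta : 'I_(nvar p G) -> R.

Local Notation L0 := (Ltrue theta None).
Local Notation Lk k := (Ltrue theta (Some k)).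
Local Notation A0 := (Amx theta None).
Local Notation A k := (Amx theta (Some k)).
Local Notation D k := (Delta theta k).

Lemma unit_Ltrue k : 1%:M - Ltrue theta k \in unitmx.
Proof. by apply: (dag_unitmx dagG) => i j; exact: Lmx0. Qed.

Lemma Delta0 k i j : ~~ connect G j i -> D k i j = 0.
Proof.
move=> nji; rewrite !mxE !(dag_inv0 dagG) ?subrr // => *; exact: Lmx0.
Qed.

Lemma Delta_diag k i : D k i i = 0.
Proof. by rewrite !mxE !(dag_inv_diag dagG) ?subrr // => *; exact: Lmx0. Qed.

(** Multiplying [D k] by [1 - L0] on the left and [1 - Lk] on the right gives [Lk - L0], which lives
    in row [k]. The unit diagonal of the inverse identifies the row factor. *)
Lemma Delta_rank1 k : D k = col k (invmx (1%:M - L0)) *m row k (D k).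
Proof.
pose s := row k (Lk k - L0) *m invmx (1%:M - Lk k).
have defD : D k = col k (invmx (1%:M - L0)) *m s.
  apply: (can_inj (mulKmx (unit_Ltrue None))).
  apply: (can_inj (mulmxK (unit_Ltrue (Some k)))) => /=.
  rewrite /Delta [_ *m (invmx _ - _)]mulmxBr mulmxBl mulmxV ?unit_Ltrue // mul1mx.
  rewrite -!mulmxA mulVmx ?unit_Ltrue // mulmx1 colE -!mulmxA mulKVmx ?unit_Ltrue //.
  rewrite mulmx1 opprB addrC addrA subrK.
  by apply/eqP; rewrite subr_eq addrC; apply/eqP; exact: Lmx_diff.
suff <- : s = row k (D k) by [].
apply/rowP=> j; rewrite defD [RHS]mxE [RHS]mxE big_ord1 [X in _ = X * _]mxE.
by rewrite (dag_inv_diag dagG) ?mul1r // => *; exact: Lmx0.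
Qed.

Lemma Amx_diff k : A k = A0 + col k A0 *m row k (D k).
Proof.
have -> : col k A0 = Ftrue theta *m col k (invmx (1%:M - L0)).
  by rewrite !colE mulmxA.
by rewrite -mulmxA -Delta_rank1 mulmxBr addrC subrK.
Qed.

(* The generators of index [Some k] and [None] differ by a column of [Amx None]
   times this row vector, so [residual = 0] is the whole content of the
   intervention on [k]. *)
Definition residual (S : comPzRingType) (iota : R -> S) (x : Var p G -> S)
    (k : 'I_q) : 'rV[S]_q :=
  map_mx iota (row k (D k)) *m (1%:M - Lmx x None)
  - row k (Lmx x (Some k) - Lmx x None).

(** Both factors on the left are rank-one updates; their quadratic term carries the entry
    [D k k k = 0] and drops out. *)
Lemma residualE (S : comPzRingType) (iota : {rmorphism R -> S})
    (x : Var p G -> S) k :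
  map_mx iota (A k) *m (1%:M - Lmx x (Some k)) =
  map_mx iota A0 *m (1%:M - Lmx x None)
  + map_mx iota (col k A0) *m residual iota x k.
Proof.
have rk0 : map_mx iota (row k (D k)) *m delta_mx k (0 : 'I_1) = 0.
  by rewrite -colE; apply/matrixP=> i j; rewrite 3!mxE Delta_diag rmorph0 mxE.
set r := map_mx iota (row k (D k)) in rk0 *; set a := map_mx iota (col k A0).
set dl := row k (Lmx x (Some k) - Lmx x None).
have aE : map_mx iota A0 *m delta_mx k 0 = a by rewrite -colE -map_col.
rewrite Amx_diff map_mxD [map_mx _ (col _ _ *m _)]map_mxM -/r -/a.
rewrite Lmx_diff -/dl opprD addrA.
have arE : (map_mx iota A0 + a *m r) *m delta_mx k 0 = a.
  by rewrite mulmxDl aE -mulmxA rk0 mulmx0 addr0.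
rewrite [LHS]mulmxDr [X in _ + X = _]mulmxN [(_ + _) *m (delta_mx _ _ *m _)]mulmxA.
rewrite arE mulmxDl -addrA; congr (_ + _).
by rewrite /residual -/r -/dl [RHS]mulmxBr mulmxA.
Qed.

(* The free part of column [j] of Lambda^(0), i.e. its entries on [ch G j]. *)
Definition lam (S : pzRingType) (x : Var p G -> S) (j : 'I_q) : 'rV[S]_#|ch G j| :=
  \row_b Lmx x None (enum_val b) j.

Lemma residual_coef (S : comPzRingType) (iota : {rmorphism R -> S})
    (x : Var p G -> S) k j :
  residual iota x k 0 j =
  iota (D k k j) - \sum_b iota (D k k (enum_val b)) * lam x j 0 b
  - (Lmx x (Some k) k j - Lmx x None k j).
Proof.
rewrite /residual mulmxBr mulmx1 [LHS]mxE [X in _ + X]mxE [row _ _ _ _]mxE.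
rewrite [(Lmx _ _ - _) _ _]mxE [(- Lmx _ _) _ _]mxE; congr (_ - _).
rewrite [LHS]mxE [X in X + _]mxE [row _ _ _ _]mxE [X in _ + X]mxE; congr (_ - _).
rewrite mxE (bigID (mem (ch G j))) /= [X in _ + X]big1 ?addr0 => [|i].
  rewrite big_enum_val /=; apply: eq_bigr => b _.
  by rewrite [X in X * _]mxE [row _ _ _ _]mxE [lam _ _ _ _]mxE.
by rewrite inE => /Lmx0 ->; rewrite mulr0.
Qed.

Lemma residual_Rset (S : comPzRingType) (iota : {rmorphism R -> S})
    (x : Var p G -> S) j (a : 'I_#|Rset G j|) :
  residual iota x (enum_val a) 0 j =
  iota (bj theta j a 0) - (lam x j *m map_mx iota (Mj theta j)^T) 0 a.
Proof.
have nG : ~~ G j (enum_val a) by have := enum_valP a; rewrite !inE => /andP[].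
rewrite residual_coef !(Lmx0 _ _ nG) subrr subr0.
rewrite [bj _ _ _ _]mxE; congr (_ - _); rewrite mxE; apply: eq_bigr => b _.
by rewrite mulrC [map_mx _ _ _ _]mxE [_^T _ _]mxE [Mj _ _ _ _]mxE.
Qed.

(** Such a [k] is no descendant of [j], hence is reached by no child of [j], and all coefficients
    vanish. For [k = j] this rests on acyclicity and the zero diagonal of [D k]. *)
Lemma residual_other (S : comPzRingType) (iota : {rmorphism R -> S})
    (x : Var p G -> S) k j :
  k \notin Rset G j -> ~~ G j k -> residual iota x k 0 j = 0.
Proof.
move=> kR nGjk; rewrite residual_coef !Lmx0 // subrr subr0.
have k_de : k \notin de G j by move: kR; rewrite !inE nGjk.
have D0 i : i \in ch G j -> D k k i = 0.
  rewrite inE => Gji; apply: Delta0; apply: contra k_de => cik; rewrite inE.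
  apply/andP; split; last exact: connect_trans (connect1 Gji) cik.
  by apply: contraTneq cik => ->; exact: dagG.
have -> : D k k j = 0.
  have [->|kj] := eqVneq k j; first exact: Delta_diag.
  by apply: Delta0; move: k_de; rewrite inE kj.
rewrite rmorph0 big1 ?subrr // => b _; rewrite D0 ?rmorph0 ?mul0r //.
exact: enum_valP.
Qed.

(** The unknown [x (inr (inr e))] enters with coefficient -1, so this equation solves for it and
    does not constrain Lambda^(0). *)
Lemma residual_edge (S : comPzRingType) (iota : {rmorphism R -> S})
    (x : Var p G -> S) (e : Edge G) (k := (val e).1) (j := (val e).2) :
  residual iota x k 0 j =
  (map_mx iota (row k (D k)) *m (1%:M - Lmx x None)) 0 j
  - (x (inr (inr e)) - x (inr (inl e))).
Proof.
rewrite /residual [LHS]mxE; congr (_ + _).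
rewrite [LHS]mxE [row _ _ _ _]mxE; congr (- _).
rewrite [LHS]mxE; congr (_ + _); first by rewrite Lmx_edge eqxx.
by rewrite mxE Lmx_edge.
Qed.

(** * Consistency at the true parameters *)

Variable l0 : 'I_p.
Hypothesis A0_neq0 : forall k, A0 l0 k != 0.

(** At the true parameters both products in [residualE] equal the true F, so column [k] of [A0]
    times the residual is zero; the entry in row [l0] cancels. *)
Lemma residual_true k : residual idfun (th theta) k = 0.
Proof.
have FE i : Amx theta i *m (1%:M - Lmx (th theta) i) = Ftrue theta.
  by rewrite mulmxKV ?unit_Ltrue.
have := residualE [the {rmorphism R -> R} of idfun] (th theta) k.
rewrite !map_mx_id // !FE => /eqP; rewrite -subr_eq0 opprD addrA subrr add0r.
rewrite oppr_eq0 => /eqP/matrixP aE; apply/rowP=> j; rewrite [RHS]mxE.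
have := aE l0 j; rewrite mxE big_ord1 [X in X * _]mxE [RHS]mxE => /eqP.
by rewrite mulf_eq0 (negPf (A0_neq0 k)) => /eqP.
Qed.

Lemma bjE j : bj theta j = Mj theta j *m (lam (th theta) j)^T.
Proof.
apply: trmx_inj; rewrite trmx_mul trmxK; apply/rowP=> a.
have := residual_Rset [the {rmorphism R -> R} of idfun] (th theta) a.
rewrite residual_true mxE [in X in _ = X - _]/= map_mx_id // => /esym/eqP.
by rewrite subr_eq0 => /eqP <-; rewrite mxE.
Qed.

Lemma residual_Rset_diff n (x : Var p G -> {mpoly R[n]}) j (a : 'I_#|Rset G j|) :
  residual (@mpolyC n R) x (enum_val a) 0 j =
  - ((lam x j - map_mx (@mpolyC n R) (lam (th theta) j))
     *m map_mx (@mpolyC n R) (Mj theta j)^T) 0 a.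
Proof.
rewrite residual_Rset bjE mulmxBl -map_mxM.
rewrite [X in _ = - X]mxE [X in _ = - (_ + X)]mxE opprB.
congr (_ - _); rewrite [RHS]mxE; congr (_ %:MP).
by rewrite -[in RHS](trmxK (lam _ _)) -trmx_mul [RHS]mxE.
Qed.

(** By [bjE] the augmented column adds no rank, which leaves the nullity of [Mj]. *)
Lemma cjE j :
  cj theta j = (\rank (row_base (kermx (Mj theta j)^T)))%:Z.
Proof.
have Mb : \rank (row_mx (Mj theta j) (bj theta j)) = \rank (Mj theta j).
  apply/eqP; rewrite eqn_leq; apply/andP; split.
    rewrite bjE -{1}[Mj theta j]mulmx1 -mul_mx_row.
    exact: mxrankM_maxl.
  have {1}-> : Mj theta j = row_mx (Mj theta j) (bj theta j) *m col_mx 1%:M 0.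
    by rewrite mul_row_col mulmx1 mulmx0 addr0.
  exact: mxrankM_maxl.
rewrite /cj Mb eqxx /= eq_row_base mxrank_ker mxrank_tr subzn //.
exact: rank_leq_col.
Qed.

(** * Polynomial parametrization of the solutions *)

Local Notation W j := (row_base (kermx (Mj theta j)^T)).
Local Notation dk j := (\rank (kermx (Mj theta j)^T)).

(* [wpar] parametrizes the solution set by coordinates [t] on the kernels of the
   [Mj theta j], and [upar] recovers [t] from a solution. *)
Definition ParamIdx : finType := {j : 'I_q & 'I_(dk j)}.
Local Notation n := #|{: ParamIdx}|.
Local Notation C := (@mpolyC n R).

Definition tvec j : 'rV[{mpoly R[n]}]_(dk j) :=
  \row_m 'X_(enum_rank (Tagged (fun j => 'I_(dk j)) m)).

Definition lamW j : 'rV[{mpoly R[n]}]_#|ch G j| :=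
  map_mx C (lam (th theta) j) + tvec j *m map_mx C (W j).

Definition L0w : 'M[{mpoly R[n]}]_q :=
  \matrix_(i, j) \sum_b (enum_val b == i)%:R * lamW j 0 b.

Definition wpar (v : Var p G) : {mpoly R[n]} :=
  match v with
  | inl lj => (map_mx C A0 *m (1%:M - L0w)) lj.1 lj.2
  | inr (inl e) => L0w (val e).1 (val e).2
  | inr (inr e) => L0w (val e).1 (val e).2
     + (map_mx C (row (val e).1 (D (val e).1)) *m (1%:M - L0w)) 0 (val e).2
  end.

Definition upar (t : ParamIdx) : {mpoly R[nvar p G]} :=
  ((lam (@Xv R p q G) (tag t) - map_mx (@mpolyC _ R) (lam (th theta) (tag t)))
   *m map_mx (@mpolyC _ R) (pinvmx (W (tag t)))) 0 (tagged t).

Lemma L0w_enum j (b : 'I_#|ch G j|) : L0w (enum_val b) j = lamW j 0 b.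
Proof.
rewrite mxE (bigD1 b) //= eqxx mul1r big1 ?addr0 // => b' bb'.
by rewrite (inj_eq enum_val_inj) (negPf bb') mul0r.
Qed.

Lemma L0w0 i j : ~~ G j i -> L0w i j = 0.
Proof.
move=> nG; rewrite mxE big1 // => b _.
case: eqVneq => [bi|_]; last by rewrite mul0r.
by have := enum_valP b; rewrite inE bi (negPf nG).
Qed.

Lemma Lmx_wpar : Lmx wpar None = L0w.
Proof.
apply/matrixP=> i j; have [Gji|nG] := boolP (G j i); last by rewrite L0w0 ?Lmx0.
exact: (@Lmx_edge _ _ _ _ wpar None (exist _ (i, j) Gji)).
Qed.

Lemma lam_wpar j : lam wpar j = lamW j.
Proof. by apply/rowP=> b; rewrite mxE Lmx_wpar L0w_enum. Qed.

(** On an edge the last branch of [wpar] is made to cancel; on [Rset] the kernel part is annihilated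
    by [Mj]; elsewhere the residual vanishes identically. *)
Lemma residual_wpar k : residual C wpar k = 0.
Proof.
apply/rowP=> j; rewrite [RHS]mxE.
have [Gjk|nGjk] := boolP (G j k).
  rewrite (@residual_edge _ _ _ (exist _ (k, j) Gjk)) /= Lmx_wpar.
  by rewrite [X in _ - X]addrAC subrr add0r subrr.
have [kR|kR] := boolP (k \in Rset G j); last exact: residual_other.
rewrite -(enum_rankK_in kR kR) residual_Rset_diff lam_wpar /lamW.
rewrite addrC addKr -mulmxA -map_mxM.
have -> : W j *m (Mj theta j)^T = 0 by apply/sub_kermxP; rewrite eq_row_base.
by rewrite map_mx0 mulmx0 mxE oppr0.
Qed.

Definition wtuple : (nvar p G).-tuple {mpoly R[n]} :=
  [tuple wpar (enum_val i) | i < nvar p G].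
Definition utuple : n.-tuple {mpoly R[nvar p G]} :=
  [tuple upar (enum_val i) | i < n].

Lemma Xv_wtuple v : Xv R v \mPo wtuple = wpar v.
Proof. by rewrite comp_mpolyXU -tnth_nth tnth_mktuple enum_rankK. Qed.

Lemma gen_wtuple k l j : gen theta k l j \mPo wtuple = 0.
Proof.
have -> : gen theta k l j \mPo wtuple =
    (Fmx wpar - map_mx C (Amx theta k) *m (1%:M - Lmx wpar k)) l j.
  have eqw : (comp_mpoly wtuple \o @Xv R p q G) =1 wpar by exact: Xv_wtuple.
  pose phi := [the {rmorphism {mpoly R[nvar p G]} -> {mpoly R[n]}} of comp_mpoly wtuple].
  rewrite -(eq_Fmx eqw) -(eq_Lmx k eqw) -(map_Fmx phi) -(map_Lmx phi) -(map_mx1 phi).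
  rewrite -(map_mx_comp_mpolyC wtuple).
  by rewrite -map_mxB -map_mxM -map_mxB [RHS]mxE.
have FE : Fmx wpar = map_mx C A0 *m (1%:M - Lmx wpar None).
  by apply/matrixP=> a b; rewrite Lmx_wpar [LHS]mxE.
case: k => [k|]; last by rewrite FE subrr mxE.
by rewrite residualE residual_wpar mulmx0 addr0 -FE subrr mxE.
Qed.

Lemma map_lam (S S' : pzRingType) (phi : {rmorphism S -> S'}) (x : Var p G -> S) j :
  map_mx phi (lam x j) = lam (phi \o x) j.
Proof. by apply/rowP=> b; rewrite 2!mxE [RHS]mxE -map_Lmx [RHS]mxE. Qed.

(** [lamW] minus the true column is [tvec] times [W], and [pinvmx] is a right inverse because the
    rows of [W] are independent. *)
Lemma upar_wtuple t : upar t \mPo wtuple = 'X_(enum_rank t).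
Proof.
case: t => j m.
pose phi := [the {rmorphism {mpoly R[nvar p G]} -> {mpoly R[n]}} of comp_mpoly wtuple].
have lamE : map_mx phi (lam (@Xv R p q G) j) = lamW j.
  rewrite map_lam -lam_wpar; apply/rowP=> b; rewrite !mxE.
  by case: insub => // e; exact: Xv_wtuple.
transitivity (map_mx phi ((lam (@Xv R p q G) j - map_mx (@mpolyC _ R) (lam (th theta) j))
   *m map_mx (@mpolyC _ R) (pinvmx (W j))) 0 m); first by rewrite [RHS]mxE.
rewrite map_mxM map_mxB !map_mx_comp_mpolyC lamE /lamW addrC addKr -mulmxA -map_mxM.
by rewrite mulmxVp ?row_base_free // map_mx1 mulmx1 mxE.
Qed.

(** * Congruences modulo an ideal containing the generators *)

Section IdealMembership.
Variable P : {mpoly R[nvar p G]} -> Prop.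
Hypotheses (iP : is_ideal P) (gensP : forall f, gens theta f -> P f).

Lemma ideal_mulmxr a b c (X : 'M[{mpoly R[nvar p G]}]_(a, b)) (Y : 'M_(b, c)) i j :
  (forall s, P (Y s j)) -> P ((X *m Y) i j).
Proof.
by move=> PY; rewrite mxE; apply: ideal_sum => // s _; have [_ _ PM] := iP; exact: PM.
Qed.

Lemma ideal_mulmxl a b c (X : 'M[{mpoly R[nvar p G]}]_(a, b)) (Y : 'M_(b, c)) i j :
  (forall s, P (X i s)) -> P ((X *m Y) i j).
Proof.
move=> PX; rewrite mxE; apply: ideal_sum => // s _; have [_ _ PM] := iP.
by rewrite mulrC; exact: PM.
Qed.

Local Notation X := (@Xv R p q G).
Local Notation CX := (@mpolyC (nvar p G) R).
Local Notation psi := (comp_mpoly utuple).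

(** In row [l0] the generators of index [None] and [Some k] differ by the residual times the
    constant [A0 l0 k], a unit. *)
Lemma residual_ideal k j : P (residual CX X k 0 j).
Proof.
have [P0 PD PM] := iP.
have genE i : gen theta i l0 j =
    Fmx X l0 j - (map_mx CX (Amx theta i) *m (1%:M - Lmx X i)) l0 j.
  by rewrite /gen [LHS]mxE; congr (_ + _); rewrite [LHS]mxE.
set r := residual _ _ _ _ _.
have rE : (map_mx CX (A k) *m (1%:M - Lmx X (Some k))) l0 j =
    (map_mx CX A0 *m (1%:M - Lmx X None)) l0 j + (A0 l0 k)%:MP * r.
  have /matrixP/(_ l0 j) :=
    residualE [the {rmorphism R -> {mpoly R[nvar p G]}} of CX] X k.
  move=> ->; rewrite [LHS]mxE; congr (_ + _); rewrite [LHS]mxE big_ord1.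
  by congr (_ * _); rewrite 2!mxE.
have PU : P ((A0 l0 k)%:MP * r).
  have -> : (A0 l0 k)%:MP * r = gen theta None l0 j - gen theta (Some k) l0 j.
    by rewrite !genE rE opprB addrC addrA subrK addrC addKr.
  by apply: idealB => //; apply: gensP; [exists None|exists (Some k)]; exists l0, j.
have := PM (A0 l0 k)^-1%:MP _ PU.
by rewrite mulrA -mpolyCM mulVf ?A0_neq0 // mul1r.
Qed.

(** By [kernel_complement] the deviation is a combination of entries of [V] times the transpose of
    [Mj], which are residuals up to sign. *)
Lemma L0w_ideal i j : P (Lmx X None i j - psi (L0w i j)).
Proof.
have [P0 PD PM] := iP.
have [Gji|nG] := boolP (G j i); last by rewrite L0w0 // Lmx0 // rmorph0 subrr.
have ich : i \in ch G j by rewrite inE.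
rewrite -(enum_rankK_in ich ich) L0w_enum; set b := enum_rank_in _ _.
set V := lam X j - map_mx CX (lam (th theta) j).
have psit : map_mx psi (tvec j) = V *m map_mx CX (pinvmx (W j)).
  apply/rowP=> m; rewrite 2!mxE comp_mpolyXU -tnth_nth tnth_mktuple.
  by rewrite enum_rankK.
have [Z defZ] := kernel_complement (Mj theta j)^T.
have -> : Lmx X None (enum_val b) j - psi (lamW j 0 b) =
    (V *m map_mx CX (Mj theta j)^T *m map_mx CX Z) 0 b.
  rewrite -mulmxA -map_mxM -defZ map_mxB map_mx1 map_mxM mulmxBr mulmx1 mulmxA -psit.
  have -> : psi (lamW j 0 b) = map_mx psi (lamW j) 0 b by rewrite [RHS]mxE.
  rewrite /lamW map_mxD map_mxM !map_mx_comp_mpolyC /V -addrA -opprD.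
  by rewrite [RHS]mxE [X in _ = X + _]mxE [X in _ = _ + X]mxE.
apply: ideal_mulmxl => a; rewrite -[_ 0 a]opprK -residual_Rset_diff.
by apply: idealN => //; exact: residual_ideal.
Qed.

Lemma Xv_ideal v : P (X v - psi (wpar v)).
Proof.
have [P0 PD PM] := iP.
have psiM a (Y : 'M[R]_(a, q)) i j :
    psi ((map_mx C Y *m (1%:M - L0w)) i j) =
    (map_mx CX Y *m (1%:M - Lmx X None)) i j
    + (map_mx CX Y *m (Lmx X None - map_mx psi L0w)) i j.
  transitivity (map_mx psi (map_mx C Y *m (1%:M - L0w)) i j); first by rewrite [RHS]mxE.
  rewrite map_mxM map_mx_comp_mpolyC map_mxB map_mx1.
  rewrite (_ : _ - map_mx _ _ = (1%:M - Lmx X None) + (Lmx X None - map_mx psi L0w)).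
    by rewrite mulmxDr mxE.
  by rewrite addrA subrK.
have PD0 a (Y : 'M[R]_(a, q)) i j :
    P ((map_mx CX Y *m (Lmx X None - map_mx psi L0w)) i j).
  apply: ideal_mulmxr => s; rewrite mxE [X in _ + X]mxE [X in _ - X]mxE.
  exact: L0w_ideal.
case: v => [[l j]|[e|e]]; rewrite /wpar.
- rewrite psiM opprD addrA; apply: idealB => //; apply: gensP.
  by exists None, l, j; rewrite /gen [RHS]mxE [X in _ = X + _]mxE [X in _ = _ + X]mxE.
- by have := L0w_ideal (val e).1 (val e).2; rewrite Lmx_edge.
rewrite rmorphD /= psiM.
have := residual_edge [the {rmorphism R -> {mpoly R[nvar p G]}} of CX] X e.
have := residual_ideal (val e).1 (val e).2.
have := L0w_ideal (val e).1 (val e).2; rewrite Lmx_edge /=.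
set r := residual _ _ _ _ _; set c := (_ *m _) _ _; set d := (_ *m _) _ _.
set a := X (inr (inl e)); set b := X (inr (inr e)); set y := psi _ => Py Pr rE.
(* The three terms are the error on Lambda^(0), the residual, and the error on Lambda^(0) carried
   through row [k] of [D k]. *)
have -> : b - (y + (c + d)) = (a - y) - r - d.
  rewrite rE opprB !opprD !addrA; congr (_ - _ - _).
  by rewrite [a - y + b]addrAC [a + b]addrC addrAC addrK.
by apply: idealB; [|exact: idealB|exact: PD0].
Qed.

End IdealMembership.

(** * Value of the dimension *)

Lemma gens_dim : ideal_dim_is (gens theta) (#|{: ParamIdx}|%:Z).
Proof.
apply: (@krull_dim_poly _ _ _ _ wtuple utuple) => [f [k [l [j ->]]]|m|P iP gP v].
- exact: gen_wtuple.
- by rewrite tnth_mktuple upar_wtuple enum_valK.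
have := Xv_ideal iP gP (enum_val v).
by rewrite /Xv enum_valK tnth_mktuple.
Qed.

Lemma sum_cj : \sum_(j < q) cj theta j = #|{: ParamIdx}|%:Z.
Proof.
rewrite card_tagged sumnE big_map big_enum /= -natz natr_sum.
by apply: eq_bigr => j _; rewrite card_ord natz cjE eq_row_base.
Qed.

Lemma cj_neqN1 : ~~ [exists j, cj theta j == -1].
Proof. by apply/existsPn => j; rewrite cjE. Qed.

End ModelTheory.

(** * Genericity as a polynomial condition *)

(** Clearing the nonzero determinant replaces the inverse by the adjugate, which is polynomial in
    [theta]. *)
Lemma Amx0_neq0 (R : realType) (p q : nat) (G : rel 'I_q)
    (theta : 'I_(nvar p G) -> R) l k :
  is_DAG G -> (Amx theta None l k != 0) =
    ((Fmx (th theta) *m \adj (1%:M - Lmx (th theta) None)) l k != 0).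
Proof.
move=> dagG; have uL := unit_Ltrue dagG theta None.
rewrite /Amx /invmx uL -scalemxAr mxE mulf_eq0 invr_eq0 negb_or.
by move: uL; rewrite unitmxE unitfE => ->.
Qed.

Theorem proposition3p8 (R : realType) (p q : nat) (G : rel 'I_q) :
  (2 <= p)%N -> (2 <= q)%N -> is_DAG G ->
  exists g : {mpoly R[nvar p G]}, g != 0 /\
    forall theta : 'I_(nvar p G) -> R,
      g.@[theta] != 0 -> param_conditions theta ->
      ideal_dim_is (gens theta)
        (if [exists j : 'I_q, cj theta j == -1] then -1
         else \sum_(j < q) cj theta j).
Proof.
move=> p_ge2 _ dagG; pose l0 : 'I_p := Ordinal (ltnW p_ge2).
pose g : {mpoly R[nvar p G]} := \prod_(k < q)
  (Fmx (@Xv R p q G) *m \adj (1%:M - Lmx (@Xv R p q G) None)) l0 k.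
have gE theta : g.@[theta] = \prod_(k < q)
    (Fmx (th theta) *m \adj (1%:M - Lmx (th theta) None)) l0 k.
  rewrite rmorph_prod; apply: eq_bigr => k _.
  pose phi := [the {rmorphism {mpoly R[nvar p G]} -> R} of meval theta].
  have eqx : (phi \o @Xv R p q G) =1 th theta by move=> v; rewrite /= mevalXU.
  rewrite -(eq_Fmx eqx) -(eq_Lmx None eqx) -(map_Fmx phi) -(map_Lmx phi).
  by rewrite -(map_mx1 phi) -map_mxB -map_mx_adj -map_mxM [RHS]mxE.
exists g; split.
  (* With F all ones and Lambda zero the adjugate is the identity and [g] evaluates to 1, so [g] is
     nonzero. *)
  pose theta1 (i : 'I_(nvar p G)) : R := if enum_val i is inl _ then 1 else 0.
  apply: contraTneq (oner_neq0 R) => g0; rewrite negbK.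
  have := gE theta1; rewrite g0 meval0 => ->; rewrite big1 // => k _.
  have -> : Lmx (th theta1) None = 0.
    apply/matrixP=> i j; rewrite !mxE; case: insub => // e.
    by rewrite /th /theta1 !enum_rankK.
  by rewrite subr0 adj1 mulmx1 mxE /th /theta1 enum_rankK.
move=> theta; rewrite gE => /prodf_neq0 gtheta _.
have A0_neq0 k : Amx theta None l0 k != 0 by rewrite Amx0_neq0 // gtheta.
rewrite (negPf (cj_neqN1 dagG A0_neq0)) (sum_cj dagG A0_neq0).
exact: (gens_dim dagG A0_neq0).
Qed.
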